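(* There exist universal constants $c_2,c_3>0$ such that the following holds. Let $\alpha_1\in[1/n,1/60]$, and let $A$ be an $n\times n$ adjacency matrix with a set $F\subseteq[n]$ satisfying $(\alpha_1,13\alpha_1,p)$-regularity. Suppose $S^*\subseteq[n]$ satisfies $|S^*|\ge(1-9\alpha_1)n$ and $\|(A-p_{S^*})_{S^*\times S^*}\|\le 20n\cdot\eta(p,n)$. Then the Trimming Algorithm on input $(n,\alpha_1,A,S^* )$ outputs $p_{S^f}$ with \[ |p_{S^f}-p|\le c_2\alpha_1\eta(p,n)+c_3\kappa(13\alpha_1,p,n). \]
   Context: Fix constants $c,c_1>0$; $\eta(p,n)=c\max\left(\sqrt{p(1-p)/n},\ \sqrt{\ln n}/n\right)$, $\kappa(\alpha,p,n)=c_1\max\left(\alpha\sqrt{\tfrac pn\ln\tfrac e\alpha},\ \tfrac\alpha n\ln\tfrac e\alpha,\ \tfrac{\sqrt{p\ln n}}{n}\right)$. For a matrix $M$ and $a\in\mathbb R$, $M-a$ subtracts $a$ entrywise; $M_{S\times S'}$ agrees with $M$ on $S\times S'$ and is zero elsewhere; $\|\cdot\|$ is the spectral norm; $p_S=\sum_{i,j\in S}A_{i,j}/|S|^2$. A set $F\subseteq[n]$ satisfies $(\alpha_1,\alpha_2,p)$-regularity (with $\alpha_1,\alpha_2\in[0,1/2)$) if: (i) $|[n]\setminus F|\le\alpha_1 n$; (ii) for all $F'\subseteq F$, $\|(A-p)_{F'\times F'}\|\le n\eta(p,n)$; (iii) for all $F',F''\subseteq F$ with $|F'|,|F''|\in[0,\alpha_2n]\cup[n-\alpha_2n,n]$,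 $\left|\sum_{i\in F'}\sum_{j\in F''}(A_{i,j}-p)\right|\le n^2\kappa(\alpha_2,p,n)$. Trimming Algorithm: for $i\in S^*$ let $p^{(i)}_{S^*}=\sum_{j\in S^*}A_{i,j}/|S^*|$ and give node $i$ the score $|p_{S^*}-p^{(i)}_{S^*}|$; remove from $S^*$ the $3\alpha_1 n$ nodes with the highest scores to obtain $S^f$; return $p_{S^f}$. *)

(* Defs.v *)
From HB Require Import structures.
From mathcomp Require Import all_boot all_order all_algebra.
From mathcomp Require Import boolp classical_sets reals.
From mathcomp Require Import sequences exp.

Set Implicit Arguments.
Unset Strict Implicit.
Unset Printing Implicit Defensive.

Import Order.TTheory GRing.Theory Num.Theory.

Local Open Scope ring_scope.

Section Definitions.
Context {R : realType}.
Implicit Types (alpha p c : R) (n : nat).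

Definition eta_rate c p n : R :=
  c * Num.max (Num.sqrt (p * (1 - p) / n%:R)) (Num.sqrt (ln n%:R) / n%:R).

Definition kappa_rate c1 alpha p n : R :=
  c1 * Num.max (alpha * Num.sqrt (p / n%:R * ln (expR 1 / alpha)))
         (Num.max (alpha / n%:R * ln (expR 1 / alpha))
                  (Num.sqrt (p * ln n%:R) / n%:R)).

Definition l2norm n (x : 'cV[R]_n) : R := Num.sqrt (\sum_i x i 0 ^+ 2).

(* The operator norm induced by the Euclidean norm; mathcomp-analysis' own
   matrix norm is the entrywise maximum. *)
Definition spectral_norm m n (M : 'M[R]_(m, n)) : R :=
  sup [set l2norm (M *m x) | x in [set x | l2norm x <= 1]]%classic.

Definition restrict_mx m n (M : 'M[R]_(m, n))
    (S : {set 'I_m}) (S' : {set 'I_n}) : 'M[R]_(m, n) :=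
  \matrix_(i, j) (if (i \in S) && (j \in S') then M i j else 0).

Definition adjacency_mx n (A : 'M[R]_n) : Prop :=
  [/\ forall i j, A i j = 0 \/ A i j = 1,
      forall i j, A i j = A j i
    & forall i, A i i = 0].

Definition density n (A : 'M[R]_n) (S : {set 'I_n}) : R :=
  (\sum_(i in S) \sum_(j in S) A i j) / #|S|%:R ^+ 2.

Definition node_density n (A : 'M[R]_n) (S : {set 'I_n}) (i : 'I_n) : R :=
  (\sum_(j in S) A i j) / #|S|%:R.

Definition extreme_card n alpha (S : {set 'I_n}) : Prop :=
  let s : R := #|S|%:R in
  0 <= s <= alpha * n%:R \/ n%:R - alpha * n%:R <= s <= n%:R.

Definition regular_set c c1 n (A : 'M[R]_n) alpha1 alpha2 p (F : {set 'I_n}) :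
    Prop :=
  [/\ 0 <= alpha1 < 1 / 2 /\ 0 <= alpha2 < 1 / 2,
      #|~: F|%:R <= alpha1 * n%:R,
      forall F' : {set 'I_n}, F' \subset F ->
        spectral_norm (restrict_mx (A - const_mx p) F' F')
          <= n%:R * eta_rate c p n
    & forall F' F'' : {set 'I_n}, F' \subset F -> F'' \subset F ->
        extreme_card alpha2 F' -> extreme_card alpha2 F'' ->
        `| \sum_(i in F') \sum_(j in F'') (A i j - p) |
          <= n%:R ^+ 2 * kappa_rate c1 alpha2 p n].

Definition score n (A : 'M[R]_n) (S : {set 'I_n}) (i : 'I_n) : R :=
  `| density A S - node_density A S i |.

(* [Sf] is a possible node set left by the trimming algorithm. Ties between
   scores may be broken arbitrarily, so this is a relation and not a function;
   the number 3 * alpha1 * n of removed nodes is rounded down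
   (rounding up could leave fewer than (1 - 13 * alpha1) * n regular nodes). *)
Definition trimming_output n alpha1 (A : 'M[R]_n) (S Sf : {set 'I_n}) : Prop :=
  [/\ Sf \subset S,
      #|S :\: Sf| = Num.truncn (3 * alpha1 * n%:R)
    & forall i j, i \in S :\: Sf -> j \in Sf -> score A S j <= score A S i].

End Definitions.

(* Main.v *)
Require Import Defs.
From HB Require Import structures.
From mathcomp Require Import all_boot all_order all_algebra.
From mathcomp Require Import boolp classical_sets reals.
From mathcomp Require Import sequences exp.
From mathcomp Require Import ring lra fintype finset.

(** Let [q] be the density of [S]. Comparing the two spectral bounds on
    [S :&: F] gives [|p - q| = O(eta)]. At most [alpha1 n] bad nodes [B := Sf :\: F] survive
    trimming, and at least as many good nodes were removed, so the total score
    of [B] is at most that of the removed good nodes [X]. The latter is bounded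
    by splitting [X * S] into [X * (S :&: F)], where regularity applies, and
    [X * (S :\: F)], where both sides have size [O(alpha1 n)] and the spectral
    bound applies. This controls [B * Sf]; the remaining block [G * G] of good
    survivors is controlled by regularity. *)

Set Implicit Arguments.
Unset Strict Implicit.
Unset Printing Implicit Defensive.

Import Order.TTheory GRing.Theory Num.Theory.

Local Open Scope ring_scope.

(** * Block deviations and their control by the spectral norm *)

Definition block_dev (R : realType) n (A : 'M[R]_n) (q : R)
    (I J : {set 'I_n}) : R :=
  \sum_(i in I) \sum_(j in J) (A i j - q).

(** Cauchy-Schwarz against the indicator of [I], obtained from the nonnegative sum of squared
    distances to the mean [t] of [y] over [I]. *)
Lemma sum_set_sqr_le (R : realType) (T : finType) (I : {set T}) (y : T -> R) :
  (\sum_(i in I) y i) ^+ 2 <= #|I|%:R * \sum_i y i ^+ 2.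
Proof.
have [->|I0] := eqVneq I set0.
  by rewrite big_set0 cards0 expr0n mul0r.
have c0 : 0 < #|I|%:R :> R by rewrite ltr0n card_gt0.
have le1 : \sum_(i in I) y i ^+ 2 <= \sum_i y i ^+ 2.
  rewrite [leRHS](bigID (mem I)) /= lerDl.
  by apply: sumr_ge0 => i _; rewrite sqr_ge0.
apply: le_trans (ler_wpM2l (ltW c0) le1).
set s := \sum_(i in I) y i; set t := s / #|I|%:R.
have : 0 <= \sum_(i in I) (y i - t) ^+ 2.
  by apply: sumr_ge0 => i _; rewrite sqr_ge0.
have sqE i : (y i - t) ^+ 2 = y i ^+ 2 - (2 * t * y i - t ^+ 2) by ring.
under eq_bigr do rewrite sqE.
rewrite sumrB sumrB -mulr_sumr sumr_const -/s -[_ *+ #|I|]mulr_natl.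
rewrite subr_ge0 => le2.
rewrite (_ : s ^+ 2 = #|I|%:R * (2 * t * s - #|I|%:R * t ^+ 2)).
  by rewrite ler_wpM2l // ltW.
by rewrite /t; field; rewrite gt_eqF.
Qed.

(** The point is that the set under [sup] is bounded above: entries of a vector in the unit ball
    have absolute value at most 1, so absolute row sums of [M] dominate the entries of the image. *)
Lemma spectral_norm_ub (R : realType) m n (M : 'M[R]_(m, n)) (x : 'cV[R]_n) :
  l2norm x <= 1 -> l2norm (M *m x) <= spectral_norm M.
Proof.
move=> x1; apply: ub_le_sup; last by exists x.
exists (Num.sqrt (\sum_i (\sum_j `|M i j|) ^+ 2)) => _ [z /= z1 <-].
rewrite ler_wsqrtr //; apply: ler_sum => i _.
rewrite -real_normK ?num_real // ler_sqr ?nnegrE ?sumr_ge0 // !mxE.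
apply: le_trans (ler_norm_sum _ _ _) _; apply: ler_sum => j _.
rewrite normrM ler_piMr // -(@ler_pXn2r _ 2) ?nnegrE // expr1n.
rewrite real_normK ?num_real //.
have zz : \sum_k z k 0 ^+ 2 <= 1.
  rewrite -(@ler_sqrt _ _ 1) // sqrtr1; exact: z1.
apply: le_trans zz; rewrite (bigD1 j) //= lerDl.
by apply: sumr_ge0 => k _; rewrite sqr_ge0.
Qed.

(** The block sum pairs the indicator of [I] with the image of the indicator of [J]; each indicator
    has Euclidean norm at most the square root of [a]. *)
Lemma block_sum_le_spectral (R : realType) n (M : 'M[R]_n) (S I J : {set 'I_n})
    (a : R) :
  I \subset S -> J \subset S -> #|I|%:R <= a -> #|J|%:R <= a ->
  `|\sum_(i in I) \sum_(j in J) M i j| <= spectral_norm (restrict_mx M S S) * a.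
Proof.
move=> IS JS Ia Ja; set N := restrict_mx M S S.
have -> : \sum_(i in I) \sum_(j in J) M i j
        = \sum_(i in I) \sum_(j in J) N i j.
  apply: eq_bigr => i /(subsetP IS) iS; apply: eq_bigr => j /(subsetP JS) jS.
  by rewrite mxE iS jS.
have a0 : 0 <= a by apply: le_trans Ia; rewrite ler0n.
have [a00|an0] := eqVneq a 0.
  have -> : I = set0.
    by apply/eqP; rewrite -cards_eq0 -leqn0 -(ler_nat R) (le_trans Ia) // a00.
  by rewrite big_set0 normr0 a00 mulr0.
have ap : 0 < a by rewrite lt_neqAle eq_sym an0.
set r := Num.sqrt a; have rp : 0 < r by rewrite sqrtr_gt0.
have rr : r ^+ 2 = a by rewrite sqr_sqrtr.
(* Dividing by [r] instead of the exact norm of the indicator keeps [x] in the unit ball even when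
   [J] is empty. *)
pose x : 'cV[R]_n := \col_j (if j \in J then r^-1 else 0).
have x1 : l2norm x <= 1.
  rewrite /l2norm -sqrtr1 ler_wsqrtr //.
  rewrite (bigID (mem J)) /= [X in _ + X]big1 ?addr0; last first.
    by move=> j /negbTE jJ; rewrite mxE jJ expr0n.
  rewrite (eq_bigr (fun=> r^-1 ^+ 2)) => [|j jJ]; last by rewrite mxE jJ.
  by rewrite sumr_const -[_ *+ _]mulr_natl exprVn rr ler_pdivrMr // mul1r.
have := spectral_norm_ub N x1; set y := N *m x => yN.
have -> : \sum_(i in I) \sum_(j in J) N i j = r * \sum_(i in I) y i 0.
  rewrite mulr_sumr; apply: eq_bigr => i _.
  rewrite mxE [in RHS](bigID (mem J)) /= [X in _ + X]big1 ?addr0; last first.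
    by move=> j /negbTE jJ; rewrite [x _ _]mxE jJ mulr0.
  rewrite mulr_sumr; apply: eq_bigr => j jJ.
  by rewrite [x _ _]mxE jJ mulrCA divff ?mulr1 // gt_eqF.
rewrite normrM gtr0_norm // -rr expr2 mulrA mulrC ler_wpM2r ?(ltW rp) //.
apply: (@le_trans _ _ (l2norm y * r)); last by rewrite ler_wpM2r // ltW.
have l0 : 0 <= l2norm y by rewrite sqrtr_ge0.
rewrite -ler_sqr ?nnegrE ?mulr_ge0 ?(ltW rp) // exprMn rr.
rewrite real_normK ?num_real //; apply: le_trans (sum_set_sqr_le _ _) _.
have s0 : 0 <= \sum_i y i 0 ^+ 2 by apply: sumr_ge0 => i _; rewrite sqr_ge0.
by rewrite sqr_sqrtr // mulrC ler_wpM2l.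
Qed.

Lemma block_dev_spectral (R : realType) n (A : 'M[R]_n) (q s a : R)
    (S I J : {set 'I_n}) :
  spectral_norm (restrict_mx (A - const_mx q) S S) <= s ->
  I \subset S -> J \subset S -> #|I|%:R <= a -> #|J|%:R <= a ->
  `|block_dev A q I J| <= s * a.
Proof.
move=> Ns IS JS Ia Ja.
have a0 : 0 <= a by apply: le_trans Ia; rewrite ler0n.
apply: le_trans (ler_wpM2r a0 Ns).
apply: le_trans (block_sum_le_spectral (A - const_mx q) IS JS Ia Ja).
rewrite /block_dev; under [X in _ <= `|X|]eq_bigr => i _ do
  under eq_bigr => j _ do rewrite !mxE.
by [].
Qed.

(** * Splitting, re-centring and normalising block deviations *)

Lemma block_dev_splitl (R : realType) n (A : 'M[R]_n) (q : R)
    (I J X : {set 'I_n}) :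
  block_dev A q I J = block_dev A q (I :&: X) J + block_dev A q (I :\: X) J.
Proof. exact: big_setID. Qed.

Lemma block_dev_splitr (R : realType) n (A : 'M[R]_n) (q : R)
    (I J X : {set 'I_n}) :
  block_dev A q I J = block_dev A q I (J :&: X) + block_dev A q I (J :\: X).
Proof. by rewrite -big_split /=; apply: eq_bigr => i _; apply: big_setID. Qed.

Lemma block_dev_sym (R : realType) n (A : 'M[R]_n) (q : R)
    (I J : {set 'I_n}) :
  (forall i j, A i j = A j i) -> block_dev A q I J = block_dev A q J I.
Proof.
move=> sA; rewrite /block_dev exchange_big /=.
by apply: eq_bigr => i _; apply: eq_bigr => j _; rewrite sA.
Qed.

Lemma block_dev_shift (R : realType) n (A : 'M[R]_n) (p q : R)
    (I J : {set 'I_n}) :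
  block_dev A p I J = block_dev A q I J + #|I|%:R * #|J|%:R * (q - p).
Proof.
have -> : #|I|%:R * #|J|%:R * (q - p) = \sum_(i in I) \sum_(j in J) (q - p).
  by rewrite !sumr_const -mulrnA -[RHS]mulr_natl mulnC natrM.
rewrite -big_split /=; apply: eq_bigr => i _.
by rewrite -big_split /=; apply: eq_bigr => j _; rewrite addrA subrK.
Qed.

Lemma block_dev_shift_le (R : realType) n (A : 'M[R]_n) (p q a b d : R)
    (I J : {set 'I_n}) :
  #|I|%:R <= a -> #|J|%:R <= b -> `|p - q| <= d ->
  `|block_dev A p I J| <= `|block_dev A q I J| + a * b * d.
Proof.
move=> Ia Jb pq; rewrite (block_dev_shift A p q).
apply: le_trans (ler_normD _ _) _; rewrite lerD2l !normrM !normr_nat distrC.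
by rewrite ler_pM ?mulr_ge0 ?ler0n // ler_pM ?ler0n.
Qed.

Lemma density_sub (R : realType) n (A : 'M[R]_n) (p : R) (S : {set 'I_n}) :
  (0 < #|S|)%N -> density A S - p = block_dev A p S S / #|S|%:R ^+ 2.
Proof.
move=> S0; have s0 : #|S|%:R != 0 :> R by rewrite pnatr_eq0 -lt0n.
rewrite (block_dev_shift A p 0) /block_dev /density.
under [in RHS]eq_bigr => i _ do under eq_bigr => j _ do rewrite subr0.
by field.
Qed.

Lemma score_row_dev (R : realType) n (A : 'M[R]_n) (S : {set 'I_n}) i :
  (0 < #|S|)%N ->
  `|\sum_(j in S) (A i j - density A S)| = #|S|%:R * score A S i.
Proof.
move=> S0; have s0 : #|S|%:R != 0 :> R by rewrite pnatr_eq0 -lt0n.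
rewrite sumrB sumr_const -[_ *+ _]mulr_natl /score /node_density.
rewrite -{2}(normr_nat R #|S|) -normrM distrC; congr `|_|.
by field.
Qed.

(** * Comparing and summing row deviations *)

(** Summing [f b <= f x] over all pairs gives [#|X|] times the left sum at most [#|B|] times the
    right one. *)
Lemma ler_sum_sep (R : realType) (T : finType) (B X : {set T}) (f : T -> R) :
  (forall x, 0 <= f x) -> (forall b x, b \in B -> x \in X -> f b <= f x) ->
  (#|B| <= #|X|)%N -> \sum_(b in B) f b <= \sum_(x in X) f x.
Proof.
move=> f0 fBX BX.
have [X0|X0] := posnP #|X|.
  move: BX; rewrite X0 leqn0 cards_eq0 => /eqP ->; rewrite big_set0.
  by apply: sumr_ge0.
rewrite -(@ler_pM2l _ #|X|%:R) ?ltr0n //.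
apply: (@le_trans _ _ (#|B|%:R * \sum_(x in X) f x)); last first.
  by rewrite ler_wpM2r ?sumr_ge0 // ler_nat.
rewrite !mulr_natl -!sumr_const [leLHS]exchange_big /=.
by apply: ler_sum => b bB; apply: ler_sum => x xX; apply: fBX.
Qed.

(** Rows with nonnegative sum and rows with negative sum each form one block, whence the factor 2
    and the hypothesis on all subsets of [I]. *)
Lemma sum_norm_rows_le (R : realType) n (A : 'M[R]_n) (q M : R)
    (I J : {set 'I_n}) :
  (forall I' : {set 'I_n}, I' \subset I -> `|block_dev A q I' J| <= M) ->
  \sum_(i in I) `|\sum_(j in J) (A i j - q)| <= 2 * M.
Proof.
move=> IM; pose P := [set i | 0 <= \sum_(j in J) (A i j - q)].
rewrite (big_setID P) /=.
have -> : \sum_(i in I :&: P) `|\sum_(j in J) (A i j - q)|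
        = block_dev A q (I :&: P) J.
  by apply: eq_bigr => i; rewrite !inE => /andP[_ /ger0_norm].
have -> : \sum_(i in I :\: P) `|\sum_(j in J) (A i j - q)|
        = - block_dev A q (I :\: P) J.
  rewrite -sumrN; apply: eq_bigr => i; rewrite !inE -ltNge => /andP[lt0 _].
  exact: ltr0_norm.
have := IM _ (subsetIl I P); have := IM _ (subsetDl I P).
by rewrite !ler_norml => /andP[? ?] /andP[? ?]; lra.
Qed.

Lemma card_setI_geR (R : realType) n (S F : {set 'I_n}) :
  #|S|%:R - #|~: F|%:R <= #|S :&: F|%:R :> R.
Proof.
rewrite lerBlDr -natrD ler_nat -(cardsID F S) leq_add2l subset_leq_card //.
by rewrite setDE subsetIr.
Qed.

(** * Error bound for the density after trimming *)

Theorem theorem4p13 (R : realType) :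
  exists c2 c3 : R, [/\ 0 < c2, 0 < c3 &
    forall (c c1 : R) (n : nat) (alpha1 p : R) (A : 'M[R]_n)
           (F S Sf : {set 'I_n}),
      0 < c -> 0 < c1 -> (0 < n)%N ->
      0 <= p <= 1 ->
      1 / n%:R <= alpha1 <= 1 / 60 ->
      adjacency_mx A ->
      regular_set c c1 A alpha1 (13 * alpha1) p F ->
      (1 - 9 * alpha1) * n%:R <= #|S|%:R ->
      spectral_norm (restrict_mx (A - const_mx (density A S)) S S)
        <= 20 * n%:R * eta_rate c p n ->
      trimming_output alpha1 A S Sf ->
      `| density A Sf - p |
        <= c2 * alpha1 * eta_rate c p n + c3 * kappa_rate c1 (13 * alpha1) p n].
Proof.
(* The final deviation is at most [5 * K + 770 * E], and [#|Sf| ^+ 2] is at least 16/25 of [N ^+ 2];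
   1204 and 8 round up 770 and 5 divided by 16/25. *)
exists 1204, 8; split=> [||c c1 n a p A F S Sf c0 c10 n0 p01 /andP[an a60]
  [_ symA _] [_ Fa specF regF] Sn specS [SfS kT trim]]; [lra|lra|].
have N0 : 0 < n%:R :> R by rewrite ltr0n.
set N : R := n%:R in N0 an Fa specF regF Sn specS kT *.
set e := eta_rate c p n in specF specS *.
set k := kappa_rate c1 (13 * a) p n in regF *.
set q := density A S in specS.
have aN : 1 <= a * N by move: an; rewrite ler_pdivrMr.
have aN60 : a * N <= N / 60 by nra.
have a0 : 0 <= a by apply: le_trans an; rewrite divr_ge0 // ltW.
have e0 : 0 <= e.
  by rewrite mulr_ge0 ?(ltW c0) // le_max sqrtr_ge0.
have le_n (X : {set 'I_n}) : #|X|%:R <= N.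
  by rewrite ler_nat; have := max_card (mem X); rewrite card_ord.
have sub_le (X Y : {set 'I_n}) : X \subset Y -> #|X|%:R <= #|Y|%:R :> R.
  by move=> XY; rewrite ler_nat subset_leq_card.
have card_badR (X : {set 'I_n}) : #|X :\: F|%:R <= a * N.
  by apply: le_trans Fa; rewrite sub_le // setDE subsetIr.
pose T := S :\: Sf; pose B := Sf :\: F; pose G := Sf :&: F; pose X := T :&: F.
have Tle : #|T|%:R <= 3 * a * N.
  by rewrite kT truncn_le //; nra.
have Tgt : 3 * a * N < #|T|%:R + 1.
  by rewrite kT natr1 truncnS_gt.
have SfE : #|Sf|%:R + #|T|%:R = #|S|%:R :> R.
  by rewrite -natrD -(cardsID Sf S) (setIidPr SfS).
have Wge := card_setI_geR R S F; have Gge := card_setI_geR R Sf F.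
have Ble : #|B|%:R <= a * N by apply: card_badR.
have small (Y : {set 'I_n}) : #|Y|%:R <= 3 * a * N -> extreme_card (13 * a) Y.
  by move=> Yl; left; rewrite ler0n /=; nra.
have large (Y : {set 'I_n}) : (1 - 13 * a) * N <= #|Y|%:R ->
    extreme_card (13 * a) Y.
  by move=> Yl; right; rewrite le_n andbT -/N; nra.
(* [B] and [T :\: F] are disjoint parts of the complement of [F], so together they have at most
   [a * N] nodes. Rounding down costs [T] less than one node, which [1 <= a * N] absorbs. *)
have BX : (#|B| <= #|X|)%N.
  suff : #|B|%:R < #|X|%:R + 1 :> R by rewrite natr1 ltr_nat.
  have : #|T :\: F|%:R + #|B|%:R <= a * N.
    apply: le_trans Fa; rewrite -natrD ler_nat -cardsUI.
    rewrite [X in (_ + X)%N](_ : _ = 0%N) ?addn0; last first.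
      by apply/eqP; rewrite cards_eq0; apply/eqP/setP => i; rewrite !inE;
         case: (i \in Sf); rewrite ?andbF.
    by rewrite subset_leq_card // -setDUl setDE subsetIr.
  have : #|X|%:R + #|T :\: F|%:R = #|T|%:R :> R by rewrite -natrD cardsID.
  by lra.
have S0 : (0 < #|S|)%N by rewrite -(ltr_nat R); nra.
have Sf0 : (0 < #|Sf|)%N by rewrite -(ltr_nat R); nra.
have specS_le (I J : {set 'I_n}) b : I \subset S -> J \subset S ->
    #|I|%:R <= b -> #|J|%:R <= b -> `|block_dev A q I J| <= 20 * N * e * b.
  by move=> *; apply: block_dev_spectral specS _ _ _ _.
(* On [W * W] the deviations from [p] and [q] differ by [#|W| ^+ 2 * (p - q)] and total at most
   [(1 + 20) * N * e * #|W|]. As [#|W|] is at least [5 / 6 * N], the factor is 21 * 6/5 < 26. *)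
have pq : `|p - q| <= 26 * e.
  set W := S :&: F in Wge; have W0 : 0 < #|W|%:R :> R by nra.
  have h1 := specS_le W W _ (subsetIl _ _) (subsetIl _ _) (lexx _) (lexx _).
  have h2 := block_dev_spectral (specF W (subsetIr _ _))
    (subxx _) (subxx _) (lexx _) (lexx _).
  have : `|#|W|%:R * #|W|%:R * (p - q)| <= 21 * N * e * #|W|%:R.
    move: h1 h2; rewrite (block_dev_shift A q p) !ler_norml.
    by move=> /andP[? ?] /andP[? ?]; apply/andP; split; lra.
  rewrite !normrM normr_nat mulrAC ler_pM2r // => h.
  rewrite -(ler_pM2l W0) (le_trans h) //.
  have : 5 / 6 * N <= #|W|%:R by nra.
  by move=> /(ler_wpM2r e0); nra.
set E := a * N ^+ 2 * e; set K := N ^+ 2 * k in regF.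
have E0 : 0 <= E := mulr_ge0 (mulr_ge0 a0 (sqr_ge0 N)) e0.
have XS : X \subset S by apply: subset_trans (subsetIl _ _) (subsetDl _ _).
(* 138 = 3 * 26 + 20 * 3: re-centring from [p] to [q] on the columns in [F], then the spectral bound
   on the others. *)
have devX (Y : {set 'I_n}) : Y \subset X -> `|block_dev A q Y S| <= K + 138 * E.
  move=> YX; have YT : Y \subset T := subset_trans YX (subsetIl _ _).
  have Y3 : #|Y|%:R <= 3 * a * N := le_trans (sub_le _ _ YT) Tle.
  rewrite (block_dev_splitr A q Y S F).
  have h1 : `|block_dev A p Y (S :&: F)| <= K.
    apply: regF; rewrite ?subsetIr //.
    - exact: subset_trans YX (subsetIr _ _).
    - exact: small.
    - by apply: large; lra.
  have qp : `|q - p| <= 26 * e by rewrite distrC.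
  have h2 := block_dev_shift_le A Y3 (le_n (S :&: F)) qp.
  have h3 : `|block_dev A q Y (S :\: F)| <= 20 * N * e * (3 * a * N).
    apply: specS_le; rewrite ?subsetDl //.
    - exact: subset_trans YT (subsetDl _ _).
    - by apply: le_trans (card_badR S) _; nra.
  apply: le_trans (ler_normD _ _) _.
  have -> : K + 138 * E = K + 3 * a * N * N * (26 * e) + 20 * N * e * (3 * a * N).
    by rewrite /E; ring.
  by apply: lerD h3; apply: le_trans h2 _; rewrite lerD2r.
have BSf : B \subset Sf := subsetDl _ _.
have BS : B \subset S := subset_trans BSf SfS.
(* The trimming rule enters here: each row of [X] scores at least as high as each row of [B], and a
   score is an absolute row deviation divided by [#|S|]. *)
have devBS : `|block_dev A q B S| <= 2 * (K + 138 * E).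
  apply: le_trans (sum_norm_rows_le devX).
  apply: le_trans (ler_norm_sum _ _ _) _.
  apply: ler_sum_sep => // b x bB xX.
  rewrite !score_row_dev // ler_wpM2l ?ler0n //; apply: trim.
    by move: xX; rewrite inE => /andP[].
  exact: (subsetP BSf).
(* 362 = 276 + 60 + 26: the block [B * S], the discarded columns [T], and re-centring from [q] to
   [p]. *)
have devBSf : `|block_dev A p B Sf| <= 2 * K + 362 * E.
  apply: le_trans (block_dev_shift_le A Ble (le_n Sf) pq) _.
  have : `|block_dev A q B T| <= 20 * N * e * (3 * a * N).
    apply: specS_le; rewrite ?subsetDl //; first by nra.
  have := block_dev_splitr A q B S Sf; rewrite (setIidPr SfS) -/T => eqB.
  have -> : block_dev A q B Sf = block_dev A q B S - block_dev A q B T.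
    by rewrite eqB addrK.
  move=> h; have := ler_normB (block_dev A q B S) (block_dev A q B T).
  have : a * N * N * (26 * e) = 26 * E by rewrite /E; ring.
  have : 20 * N * e * (3 * a * N) = 60 * E by rewrite /E; ring.
  by lra.
have devBB : `|block_dev A p B B| <= 46 * E.
  apply: le_trans (block_dev_shift_le A Ble (le_n B) pq) _.
  have := specS_le _ _ _ BS BS Ble Ble.
  have : a * N * N * (26 * e) = 26 * E by rewrite /E; ring.
  have : 20 * N * e * (a * N) = 20 * E by rewrite /E; ring.
  by lra.
have devGG : `|block_dev A p G G| <= K.
  have Gl : extreme_card (13 * a) G by apply: large; rewrite -/G in Gge; lra.
  by apply: regF; rewrite ?subsetIr.
(* By symmetry, [Sf * Sf] equals [G * G] plus twice [B * Sf] minus [B * B], as [B * B] is counted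
   twice; 770 = 2 * 362 + 46. *)
have devSf : `|block_dev A p Sf Sf| <= 5 * K + 770 * E.
  have e1 := block_dev_splitl A p Sf Sf F.
  have e2 := block_dev_splitr A p G Sf F.
  have e3 := block_dev_splitl A p Sf B F.
  rewrite -/G -/B in e1 e2 e3; rewrite (block_dev_sym p Sf B symA) in e3.
  move: devBSf devBB devGG; rewrite !ler_norml.
  by move=> /andP[? ?] /andP[? ?] /andP[? ?]; apply/andP; split; lra.
rewrite density_sub // normrM normfV (ger0_norm (sqr_ge0 _)).
(* At most [(9 + 3) * a * N] nodes lie outside [Sf], and [a] is at most 1/60. *)
have Sf8 : 4 / 5 * N <= #|Sf|%:R by lra.
have Sfsq : 16 / 25 * N ^+ 2 <= #|Sf|%:R ^+ 2 by nra.
rewrite ler_pdivrMr ?exprn_gt0 ?ltr0n //; apply: le_trans devSf _.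
have k0 : 0 <= k.
  by rewrite mulr_ge0 ?(ltW c10) // !le_max !divr_ge0 ?sqrtr_ge0 ?orbT // ltW.
have ae0 : 0 <= a * e by rewrite mulr_ge0.
apply: (@le_trans _ _ ((1204 * a * e + 8 * k) * (16 / 25 * N ^+ 2))); last first.
  by rewrite ler_wpM2l //; lra.
have kN : 0 <= k * N ^+ 2 by rewrite mulr_ge0 // sqr_ge0.
by rewrite /K; move: E0; rewrite /E; nra.
Qed.
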